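(* Let $f, g \in \mathbb{C}[\mathbf{z}] = \mathbb{C}[z_1,\ldots,z_n]$ be such that the polynomial $g(\mathbf{z}) + y f(\mathbf{z}) \in \mathbb{C}[\mathbf{z}, y]$ is stable, and assume that $\rho_{\mathbf{v}}(f) \le 1$ for some $\mathbf{v} \in \mathbb{R}^n_{\ge 0}$. Then $g(\mathbf{z}) - \partial_{\mathbf{v}} f(\mathbf{z}) \in \mathbb{C}[\mathbf{z}]$ is stable or identically $0$.
   Context: A polynomial $h\in\mathbb{C}[z_1,\dots,z_m]$ is called stable if $h(\mathbf{z})\neq 0$ for all $\mathbf{z}\in\mathbb{C}^m$ with $\mathrm{Im}(z_j)>0$ for all $j=1,\dots,m$. For $\mathbf{v}\in\mathbb{R}^n$, $\partial_{\mathbf{v}} f(\mathbf{z})=\frac{d}{dt} f(\mathbf{z}+t\mathbf{v})\big|_{t=0}$ is the directional derivative, and $\rho_{\mathbf{v}}(f)$, the degree of $f$ in direction $\mathbf{v}$, is the degree of the univariate polynomial $f(\mathbf{w}+t\mathbf{v})\in\mathbb{C}[t]$ for generic $\mathbf{w}\in\mathbb{C}^n$. *)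

(* Defs.v *)
From mathcomp Require Import all_boot all_order all_algebra.
From mathcomp Require Export complex mpoly.
From mathcomp Require Export reals.

Set Implicit Arguments.
Unset Strict Implicit.
Unset Printing Implicit Defensive.

Import GRing.Theory Num.Theory.
Local Open Scope ring_scope.
Local Open Scope complex_scope.

Section Definitions.
Variables (R : realType) (n : nat).
Implicit Types (f h : {mpoly R[i][n]}) (v : 'I_n -> R) (w : 'I_n -> R[i]).

Definition stable h : Prop :=
  forall z : 'I_n -> R[i], (forall j, 0 < complex.Im (z j)) -> h.@[z] != 0.

(* The univariate polynomial f(w + t v) in C[t]. *)
Definition restrict_line w v f : {poly R[i]} :=
  mmap polyC (fun i => (w i)%:P + (v i)%:C%:P * 'X) f.

(* Genericity is in the Zariski sense: P holds off the zero set of some nonzero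
   polynomial. *)
Definition generically (P : ('I_n -> R[i]) -> Prop) : Prop :=
  exists2 q : {mpoly R[i][n]}, q != 0 & forall w, q.@[w] != 0 -> P w.

(* [directional_degree v f d] means rho_v(f) = d. The zero polynomial is given
   degree 0 here, because of the truncated predecessor. *)
Definition directional_degree v f (d : nat) : Prop :=
  generically (fun w => (size (restrict_line w v f)).-1 = d).

(* The polynomial f(z + t v), as a polynomial in t over C[z]. *)
Definition translate v f : {poly {mpoly R[i][n]}} :=
  mmap (polyC \o @mpolyC n R[i]) (fun i => ('X_i)%:P + (v i)%:C%:MP%:P * 'X) f.

(* d/dt f(z + t v) at t = 0. *)
Definition directional_deriv v f : {mpoly R[i][n]} :=
  ((translate v f)^`()).[0].

End Definitions.

(* Main.v *)
Require Import Defs.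
From mathcomp Require Import all_boot all_order all_algebra.
From mathcomp Require Import complex mpoly reals ring lra.
Import Order.TTheory GRing.Theory Num.Theory.
Local Open Scope ring_scope.
Local Open Scope complex_scope.

(** Write D for the directional derivative of f along v. Letting y tend to infinity in g + y f
    shows that f is stable or 0, and the case f = 0 is trivial. If f is stable, then for z and y
    in the upper half-plane the point z - v/y is there too, so the directional degree bound
    gives y f(z - v/y) = y f(z) - D(z) <> 0; hence Im (D/f) <= 0, while stability of g + y f
    means Im (g/f) >= 0. So g - D + y f does not vanish either, and y -> 0 gives the claim.
    Both limits are instances of the same Hurwitz-type fact, proved on complex lines: if
    a + y b does not vanish on the upper half-plane, then a is stable or 0. *)

(** * The Hurwitz-type fact in one variable *)

Lemma horner_near0 (R : rcfType) (p : {poly R[i]}) (c : R) : 0 < c ->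
  exists2 e : R, 0 < e & forall t : R[i], `|t| < e%:C -> `|p.[t] - p.[0]| < c%:C.
Proof.
elim/poly_ind: p c => [c c0|p a IH c c0].
  by exists 1 => // t _; rewrite !horner0 subrr normr0 ltcR.
have [e e0 he] := IH 1 ltr01.
have [y yE] : exists y : R, `|p.[0]| = y%:C by eexists; exact: normc_def.
pose b := 1 + y.
have bE : b%:C = 1 + `|p.[0]| by rewrite yE rmorphD rmorph1.
have b0 : 0 < b by rewrite -ltcR bE ltr_wpDr.
exists (Num.min e (c / b)) => [|t]; first by rewrite lt_min e0 divr_gt0.
have [x tx] : exists x : R, `|t| = x%:C by eexists; exact: normc_def.
rewrite tx ltcR lt_min => /andP[xe xc].
have {}he : `|p.[t]| < b%:C.
  rewrite bE -[p.[t]](subrK p.[0]) (le_lt_trans (ler_normD _ _)) // ltrD2r.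
  by rewrite he // tx ltcR.
rewrite !hornerMXaddC mulr0 add0r addrK normrM.
have xge0 : 0 <= x by rewrite -ler0c -tx.
apply: (@le_lt_trans _ _ (b%:C * `|t|)); first by rewrite ler_wpM2r // ltW.
by rewrite tx -rmorphM /= ltcR mulrC -ltr_pdivlMr.
Qed.

(** The real part of a / b has the sign of Re a Re b + Im a Im b, where the first product exceeds
    1/4 and the second is less than 1/4 in absolute value. *)
Lemma Re_div_near1 (R : rcfType) (a b : R[i]) :
  `|a - 1| < (2^-1)%:C -> `|b - 1| < (2^-1)%:C -> 0 < complex.Re (a / b).
Proof.
have H (z : R[i]) : `|z - 1| < (2^-1)%:C -> 2^-1 < complex.Re z /\ `|complex.Im z| < 2^-1.
  case: z => x y; rewrite normc_def ltcR /= subr0 => h; split.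
    have : `|x - 1| < 2^-1.
      by apply: le_lt_trans h; rewrite -sqrtr_sqr ler_wsqrtr // lerDl sqr_ge0.
    rewrite ltr_norml; lra.
  by apply: le_lt_trans h; rewrite -sqrtr_sqr ler_wsqrtr // lerDr sqr_ge0.
move=> /H; case: a => a1 a2 /= [ha1]; rewrite ltr_norml => /andP[ha2 ha3].
move=> /H; case: b => b1 b2 /= [hb1]; rewrite ltr_norml => /andP[hb2 hb3].
have n0 : 0 < b1 ^+ 2 + b2 ^+ 2 by rewrite ltr_wpDr ?sqr_ge0 // exprn_gt0 //; lra.
rewrite -(pmulr_lgt0 _ n0).
set u := (X in 0 < X).
have -> : u = a1 * b1 + a2 * b2 by rewrite /u; field; lra.
nra.
Qed.

(* If p = 'X^k p1 with k > 0, then along the ray t = s w, where w^k p1(0)/q(0) = -i, the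
   root y = - p(t)/q(t) of p(t) + y q(t) is asymptotic to i s^k. *)
Lemma hurwitz_pencil0 (R : rcfType) (p q : {poly R[i]}) (e : R) : 0 < e ->
  (forall t y : R[i], `|t| < e%:C -> 0 < complex.Im y -> p.[t] + y * q.[t] != 0) ->
  p.[0] = 0 -> q.[0] != 0 -> p = 0.
Proof.
move=> e0 hpq p0 q0; apply: contraTeq isT => pn0.
have [k [p1]] := multiplicity_XsubC p 0; rewrite pn0 subr0 /= => p1n0 pE.
have {p1n0} p10 : p1.[0] != 0 by exact: p1n0.
have k0 : (0 < k)%N.
  by case: k pE p0 => // ->; rewrite expr0 mulr1 => /eqP; rewrite (negbTE p10).
pose w := k.-root (- 'i * q.[0] / p1.[0]).
have wE : w ^+ k = - 'i * q.[0] / p1.[0] by rewrite rootCK.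
have h2 : 0 < (2^-1 : R) by lra.
have [e1 e10 h1] := horner_near0 _ (p1.[0]^-1 *: p1) _ h2.
have [e2 e20 h3] := horner_near0 _ (q.[0]^-1 *: q) _ h2.
pose m := Num.min e (Num.min e1 e2).
have m0 : 0 < m by rewrite !lt_min e0 e10.
have [y yE] : exists y : R, `|w| = y%:C by eexists; exact: normc_def.
pose b := 1 + y.
have bE : b%:C = 1 + `|w| by rewrite yE rmorphD rmorph1.
have b0 : 0 < b by rewrite -ltcR bE ltr_wpDr.
(* Dividing by 1 + |w| keeps |t| = s |w| strictly below [m]. *)
pose s := m / b.
have s0 : 0 < s by rewrite divr_gt0.
pose t := s%:C * w.
have tm : `|t| < m%:C.
  have -> : m%:C = s%:C * b%:C by rewrite -rmorphM /= divfK // gt_eqF.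
  by rewrite /t normrM gtr0_norm ?ltcR // bE ltr_pM2l ?ltrDr ?ltr01 // ltcR.
have lt_t d : m <= d -> `|t| < d%:C by move=> md; apply: (lt_le_trans tm); rewrite lecR.
have te : `|t| < e%:C by rewrite lt_t // ge_min lexx.
have {}h1 : `|p1.[t] / p1.[0] - 1| < (2^-1)%:C.
  have := h1 t; rewrite !hornerZ mulVf // mulrC; apply.
  by rewrite lt_t // !ge_min lexx orbT.
have {}h3 : `|q.[t] / q.[0] - 1| < (2^-1)%:C.
  have := h3 t; rewrite !hornerZ mulVf // mulrC; apply.
  by rewrite lt_t // !ge_min lexx !orbT.
have qt0 : q.[t] != 0.
  apply: contraTneq h3 => ->; rewrite mul0r sub0r normrN1 -[1]/(1%:C) ltcR; lra.
have re := Re_div_near1 _ _ _ h1 h3.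
have := hpq t (- p.[t] / q.[t]) te; rewrite divfK // subrr eqxx; apply.
(* The root is exactly i s^k times a quotient of two numbers near 1; that quotient has positive real
   part, so the root lies in the upper half-plane. *)
have -> : - p.[t] / q.[t]
        = 'i * ((s ^+ k)%:C * (p1.[t] / p1.[0] / (q.[t] / q.[0]))).
  rewrite pE hornerM hornerXn exprMn wE rmorphXn /=.
  by field; rewrite p10 qt0 q0.
rewrite mulrC ImiRe; case: (_ / _) re => x1 x2 /= re.
by rewrite mul0r subr0 mulr_gt0 // exprn_gt0.
Qed.

(** * Evaluation, restriction to lines and directional derivatives *)

Lemma rmorph_mmap (n : nat) (R : nzRingType) (S T : comNzRingType)
    (phi : {rmorphism S -> T}) (f : R -> S) (h : 'I_n -> S) (p : {mpoly R[n]}) :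
  phi (mmap f h p) = mmap (phi \o f) (phi \o h) p.
Proof.
rewrite /mmap rmorph_sum; apply: eq_bigr => m _.
rewrite rmorphM rmorph_prod; congr (_ * _).
by apply: eq_bigr => i _; rewrite rmorphXn.
Qed.

Lemma eq_mmap (n : nat) (R S : nzRingType) (f1 f2 : R -> S) (h1 h2 : 'I_n -> S) :
  f1 =1 f2 -> h1 =1 h2 -> mmap f1 h1 =1 mmap f2 h2.
Proof.
move=> ef eh p; apply: eq_bigr => m _.
by rewrite ef (mmap1_eq _ eh).
Qed.

Lemma meval_mwiden (n : nat) (R : comNzRingType) (x : 'I_n.+1 -> R) (p : {mpoly R[n]}) :
  (mwiden p).@[x] = p.@[x \o widen_ord (leqnSn n)].
Proof.
rewrite /mwiden rmorph_mmap; apply: eq_mmap => [c|i] /=; first by rewrite mevalC.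
by rewrite mevalXU.
Qed.

Lemma muniK (n : nat) (R : comNzRingType) (p : {mpoly R[n.+1]}) :
  (map_poly (@mwiden n R) (muni p)).['X_ord_max] = p.
Proof.
rewrite muniE [RHS]mpolyE rmorph_sum horner_sum; apply: eq_bigr => m _.
rewrite -[in LHS]mul_polyC !rmorphM /= map_polyC /= map_polyXn hornerM hornerC hornerXn.
rewrite mwidenZ mwidenX -scalerAl mpolyXn -mpolyXD; congr (_ *: 'X_[_]).
apply/mnmP => i; rewrite mnmDE mulmnE mnm1E.
case: (unliftP ord_max i) => [j|] ->.
  have -> : lift ord_max j = widen_ord (leqnSn n) j by apply: val_inj; exact: lift_max.
  rewrite mnmwiden_widen mnmE -val_eqE /= gtn_eqF ?ltn_ord //.
  by rewrite mul0n addn0.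
by rewrite mnmwiden_ordmax eqxx mul1n.
Qed.

Lemma meval_muni (n : nat) (R : comNzRingType) (x : 'I_n.+1 -> R) (p : {mpoly R[n.+1]}) :
  p.@[x] = (map_poly (meval (x \o widen_ord (leqnSn n))) (muni p)).[x ord_max].
Proof.
rewrite -[in LHS](muniK _ _ p) -horner_map /= mevalXU -map_poly_comp /=.
by congr (_.[_]); apply: eq_map_poly => q /=; rewrite meval_mwiden.
Qed.

Definition extend {n : nat} {T : Type} (x : 'I_n -> T) (t : T) : 'I_n.+1 -> T :=
  fun i => oapp x t (unlift ord_max i).

Lemma extend_max (n : nat) (T : Type) (x : 'I_n -> T) t : extend x t ord_max = t.
Proof. by rewrite /extend unlift_none. Qed.

Lemma extend_widen (n : nat) (T : Type) (x : 'I_n -> T) t i :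
  extend x t (widen_ord (leqnSn n) i) = x i.
Proof.
rewrite /extend.
have -> : widen_ord (leqnSn n) i = lift ord_max i.
  by apply: val_inj; rewrite /= /bump leqNgt ltn_ord.
by rewrite liftK.
Qed.

Lemma poly_eq0_horner (R : numDomainType) (p : {poly R}) :
  (forall t, p.[t] = 0) -> p = 0.
Proof.
move=> p0; apply: (@roots_geq_poly_eq0 _ _ [seq i%:R | i <- iota 0 (size p)]).
- by apply/allP => t _; apply/eqP.
- rewrite map_inj_uniq ?iota_uniq // => i j /eqP.
  by rewrite eqr_nat => /eqP.
- by rewrite size_map size_iota.
Qed.

(** Induction on the number of variables: with the other coordinates fixed, p is a univariate
    polynomial in the last one that vanishes everywhere, so each of its coefficients vanishes at
    every point. *)
Lemma mpoly_eq0_meval (n : nat) (R : numDomainType) (p : {mpoly R[n]}) :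
  (forall x, p.@[x] = 0) -> p = 0.
Proof.
elim: n p => [|n IH] p p0.
  by move: (p0 (fun=> 0)); rewrite [p]nvar0_mpolyC mevalC => ->; rewrite mpolyC0.
rewrite -(muniK _ _ p).
suff -> : muni p = 0 by rewrite map_poly0 horner0.
apply/polyP => k; rewrite coef0; apply: IH => x.
rewrite -coef_map /=.
suff -> : map_poly (meval x) (muni p) = 0 by rewrite coef0.
apply: poly_eq0_horner => t.
rewrite -(p0 (extend x t)) meval_muni extend_max; congr (_.[_]).
by apply: eq_map_poly => q /=; apply: meval_eq => i /=; rewrite extend_widen.
Qed.

(** Unlike in [restrict_line], the direction may be complex, so that a line can join any two points
    of complex space. *)
Definition line {n : nat} {R : nzRingType} (w u : 'I_n -> R) (p : {mpoly R[n]}) : {poly R} :=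
  mmap polyC (fun i => (w i)%:P + (u i)%:P * 'X) p.

Lemma horner_line (n : nat) (R : comNzRingType) (w u : 'I_n -> R) (p : {mpoly R[n]}) t :
  (line w u p).[t] = p.@[fun i => w i + u i * t].
Proof.
rewrite -[LHS]/(horner_eval t _) /line rmorph_mmap.
by apply: eq_mmap => [c|i] /=; rewrite /horner_eval ?hornerE.
Qed.

Lemma map_translate (R : realType) (n : nat) (v : 'I_n -> R) (f : {mpoly R[i][n]}) w :
  map_poly (meval w) (translate v f) = restrict_line w v f.
Proof.
rewrite /translate rmorph_mmap; apply: eq_mmap => [c|i] /=.
  by rewrite map_polyC /= mevalC.
by rewrite rmorphD rmorphM /= !map_polyC /= mevalXU mevalC map_polyX.
Qed.

Lemma meval_directional_deriv (R : realType) (n : nat) (v : 'I_n -> R)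
    (f : {mpoly R[i][n]}) w :
  (directional_deriv v f).@[w] = (restrict_line w v f)^`().[0].
Proof.
by rewrite -map_translate deriv_map /directional_deriv -horner_map /= meval0.
Qed.

Lemma horner_size2 (R : comNzRingType) (p : {poly R}) t : (size p <= 2)%N ->
  p.[t] = p.[0] + p^`().[0] * t.
Proof.
move=> p2; rewrite (horner_coef_wide _ p2) !big_ord_recl big_ord0 /=.
by rewrite !horner_coef0 coef_deriv mulr1n expr0 mulr1 expr1 addr0.
Qed.

(** The degree bound is only generic in w, but for k >= 2 the coefficient of t^k in f(z + t v) is a
    polynomial in z. Its product with [q] vanishes everywhere, so the coefficient is 0 and the
    expansion holds at every point. *)
Lemma meval_directional_degree1 (R : realType) (n : nat) (v : 'I_n -> R)
    (f : {mpoly R[i][n]}) d : directional_degree v f d -> (d <= 1)%N ->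
  forall w t, f.@[fun i => w i + (v i)%:C * t]
            = f.@[w] + (directional_deriv v f).@[w] * t.
Proof.
move=> [q q0 hq] d1 w t; rewrite meval_directional_deriv.
have lineE : restrict_line w v f = line w (fun i => (v i)%:C) f by [].
have <- : (restrict_line w v f).[0] = f.@[w].
  by rewrite lineE horner_line; apply: meval_eq => i; rewrite mulr0 addr0.
rewrite -horner_line -lineE; apply: horner_size2.
apply/leq_sizeP => k k2; rewrite -map_translate coef_map /=.
suff -> : (translate v f)`_k = 0 by rewrite meval0.
apply/eqP; have : q * (translate v f)`_k == 0.
  apply/eqP/mpoly_eq0_meval => x; rewrite mevalM.
  have [->|qx] := eqVneq q.@[x] 0; first by rewrite mul0r.
  rewrite -[X in _ * X]coef_map /= map_translate nth_default ?mulr0 //.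
  (* Degree at most 1 means size at most 2, also for the zero polynomial, where the predecessor is
     truncated. *)
  apply: leq_trans k2; move: d1; rewrite -(hq x qx).
  by case: (size _).
by rewrite mulf_eq0 (negPf q0).
Qed.

(** * From one variable to several along complex lines *)

Lemma upper_half_open (R : realType) (n : nat) (z u : 'I_n -> R[i]) :
  (forall j, 0 < complex.Im (z j)) ->
  exists2 e : R, 0 < e &
    forall (t : R[i]) j, `|t| < e%:C -> 0 < complex.Im (z j + u j * t).
Proof.
move=> hz.
have [r rE] : exists r : 'I_n -> R, forall j, `|u j| = (r j)%:C.
  by eexists => j; exact: normc_def.
have r0 j : 0 <= r j by rewrite -ler0c -rE.
(* The sum bounds all the ratios |u j| / Im (z j) at once, so the radius 1 / (1 + S) serves every
   coordinate. *)
pose S := \sum_j (r j / complex.Im (z j)).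
have S0 : 0 <= S by apply: sumr_ge0 => j _; rewrite divr_ge0 // ltW.
have S1 : 0 < 1 + S by rewrite ltr_wpDr.
exists (1 + S)^-1 => [|t j]; first by rewrite invr_gt0.
have [x xE] : exists x : R, `|t| = x%:C by eexists; exact: normc_def.
have x0 : 0 <= x by rewrite -ler0c -xE.
rewrite xE ltcR => xS.
have h1 : `|complex.Im (u j * t)| <= r j * x.
  rewrite -lecR rmorphM /= -rE -xE -normrM normc_def lecR -sqrtr_sqr ler_wsqrtr //.
  by rewrite lerDr sqr_ge0.
have h2 : r j / complex.Im (z j) <= S.
  rewrite /S (bigD1 j) //= lerDl sumr_ge0 // => i _.
  by rewrite divr_ge0 // ltW.
have h3 : r j * x < complex.Im (z j).
  rewrite ler_pdivrMr // in h2.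
  have h4 : S * x < 1.
    by move: xS; rewrite -[_^-1]mul1r ltr_pdivlMr // mulrDr mulr1 mulrC; lra.
  by have := hz j; nra.
have -> : complex.Im (z j + u j * t) = complex.Im (z j) + complex.Im (u j * t).
  by case: (z j) (u j * t) => ? ? [].
by move: h1; rewrite ler_norml => /andP[h1 _]; lra.
Qed.

(** Suppose f vanishes at a point z of the upper half-space. The line from z to any x stays in the
    upper half-space near z, so the one-variable fact makes f vanish on the whole line, in
    particular at x. *)
Lemma stable_pencil0 (R : realType) (n : nat) (f g : {mpoly R[i][n]}) :
  (forall z y, (forall j, 0 < complex.Im (z j)) -> 0 < complex.Im y ->
    f.@[z] + y * g.@[z] != 0) ->
  stable f \/ f = 0.
Proof.
move=> hfg; have [->|f0] := eqVneq f 0; [by right|left] => z hz.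
apply: contra f0 => /eqP fz; apply/eqP/mpoly_eq0_meval => x.
pose u j := x j - z j.
have at0 h : (line z u h).[0] = h.@[z].
  by rewrite horner_line; apply: meval_eq => i; rewrite mulr0 addr0.
have [e e0 he] := upper_half_open _ _ z u hz.
suff f0 : line z u f = 0.
  have : (line z u f).[1] = 0 by rewrite f0 horner0.
  rewrite horner_line => <-; apply: meval_eq => i.
  by rewrite mulr1 /u addrC subrK.
apply: (hurwitz_pencil0 _ _ (line z u g) _ e0) => [t y te hy||].
- by rewrite !horner_line; apply: hfg => // j; apply: he.
- by rewrite at0.
- have := hfg z 'i hz ltr01; rewrite fz add0r at0.
  by apply: contraNneq => ->; rewrite mulr0.
Qed.

Lemma Im_invN_gt0 (R : realType) (y : R[i]) :
  0 < complex.Im y -> 0 < complex.Im (- y^-1).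
Proof.
case: y => a b /= b0; rewrite opprK divr_gt0 //.
by rewrite ltr_wpDl ?sqr_ge0 // exprn_gt0.
Qed.

Theorem corollary3p6 (R : realType) (n : nat) (f g : {mpoly R[i][n]})
    (hstable : stable (mwiden g + 'X_(@ord_max n) * mwiden f))
    (v : 'I_n -> R) (hv : forall i, 0 <= v i)
    (d : nat) (hd : directional_degree v f d) (hd1 : (d <= 1)%N) :
  stable (g - directional_deriv v f) \/ g - directional_deriv v f = 0.
Proof.
have hgf z y : (forall j, 0 < complex.Im (z j)) -> 0 < complex.Im y ->
    g.@[z] + y * f.@[z] != 0.
  move=> hz hy.
  have : forall j, 0 < complex.Im (extend z y j).
    by move=> j; rewrite /extend; case: unlift.
  move=> /hstable; rewrite mevalD mevalM mevalXU extend_max !meval_mwiden.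
  by rewrite !(meval_eq (v2 := z)) // => i /=; rewrite extend_widen.
have [f_stable|f0] : stable f \/ f = 0.
(* Since -f + y g = y (g + (-1/y) f) and -1/y stays in the upper half-plane, the limit y to infinity
   becomes a limit at 0. *)
- have [z y hz hy|sf|/eqP] := @stable_pencil0 R n (- f) g.
  + have y0 : y != 0 by apply: contraTneq hy => ->; rewrite ltxx.
    have := hgf z (- y^-1) hz (Im_invN_gt0 _ _ hy).
    apply: contra => /eqP h; rewrite -(mulrI_eq0 _ (mulfI y0)).
    by rewrite mulrDr mulrA mulrN divff // mulN1r addrC -mevalN h.
  + by left=> z /sf; rewrite mevalN oppr_eq0.
  + by rewrite oppr_eq0 => /eqP; right.
- apply: (@stable_pencil0 R n _ f) => z y hz hy; apply/eqP.
  rewrite mevalB; set D := (directional_deriv v f).@[z] => h.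
  have fz := f_stable z hz.
  have [Df|Df] := ltP 0 (complex.Im (D / f.@[z])).
  + have D0 : D != 0 by apply: contraTneq Df => ->; rewrite mul0r ltxx.
    (* With t = -f/D, which has positive imaginary part here, f(z + t v) = f + t D = 0. As v >= 0,
       the point z + t v is still in the upper half-space, against stability of f. *)
    have := f_stable (fun i => z i + (v i)%:C * (- (D / f.@[z])^-1)).
    rewrite (meval_directional_degree1 _ _ _ _ _ hd hd1) -/D invf_div.
    rewrite mulrN mulrCA divff // mulr1 subrr eqxx => h'.
    suff /h' : forall j, 0 < complex.Im (z j + (v j)%:C * - (f.@[z] / D)) by [].
    move=> j.
    have := Im_invN_gt0 _ _ Df; rewrite invf_div.
    move: (- (_ / D)) (hz j) (hv j) => [a b]; case: (z j) => a1 b1 /= hb1 hvj hb.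
    by rewrite mul0r addr0 ltr_wpDr // mulr_ge0 // ltW.
  (* Here y - D/f has positive imaginary part, and g + (y - D/f) f = g - D + y f. *)
  + have := hgf z (y - D / f.@[z]) hz.
    rewrite mulrBl divfK // addrA addrAC h eqxx => /(_ _)/negP; case=> //.
    move: Df hy; case: (D / _) y {h} => a1 b1 [a b] /= hb1 hb; lra.
- have -> : directional_deriv v f = 0.
    by rewrite f0 /directional_deriv /translate mmap0 deriv0 horner0.
  left=> z hz; rewrite subr0; have := hgf z 'i hz ltr01.
  by rewrite f0 meval0 mulr0 addr0.
Qed.
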